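(* Let $\alpha\ge 1$ be a parameter and let $G$ be a simple graph with $n$ vertices, $m$ edges, and minimum degree $\delta>\omega(\max\{\alpha\log n,\alpha k\})$. Then $G$ can be contracted into a multigraph $\overline G$ such that: (1) if the minimum $k$-cut of $G$ has size at most $\alpha\delta$, then every nontrivial minimum $k$-cut of $G$ is preserved in $\overline G$, i.e., no edge of such a cut is contracted in $\overline G$; (2) $\overline G$ has $\tilde O(\alpha m/\delta)$ edges and $\tilde O(\alpha m/\delta^2)$ vertices.
   Context: A $k$-cut of a graph $G=(V,E)$ is a partition $S_1,\ldots,S_k$ of $V$ into $k$ nonempty parts; its edge set consists of edges with endpoints in different parts, and its size is the number of such edges. A minimum $k$-cut $S^*_1,\ldots,S^*_k$ is nontrivial if no part $S^*_i$ has size $1$. Contracting two vertices $u,v$ replaces them by a single new vertex $x$; every edge with an endpoint in $\{u,v\}$ and the other endpoint outside becomes incident to $x$ (keeping its identity), edges between $u$ and $v$ are deleted, and all other edges are unchanged; thus the result may be a multigraph, and an edge of $G$ ''is contracted'' if it is deleted in this way at some step. $\tilde O(\cdot)$ hides polylogarithmic factors. *)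

(* Defs.v *)
From mathcomp Require Import all_boot all_order all_algebra.
Set Implicit Arguments.
Unset Strict Implicit.
Unset Printing Implicit Defensive.
Import Order.TTheory GRing.Theory Num.Theory.

(* Simple graphs on a finite vertex type. *)

Record sgraph (T : finType) := SGraph {
  adj : rel T;
  adj_sym : symmetric adj;
  adj_irrefl : irreflexive adj
}.

Section SimpleGraphs.
Variables (T : finType) (G : sgraph T).

Definition edge_set : {set {set T}} :=
  [set [set x; y] | x in T, y in T & adj G x y].

Definition degree (x : T) : nat := #|[set y | adj G x y]|.

(* All degrees are < #|T|, so the default value #|T| is irrelevant as soon as
   there is a vertex. *)
Definition min_degree : nat := \big[Order.min/#|T|]_(x : T) degree x.

(* [partition] already requires the parts to be nonempty. *)
Definition is_kcut (k : nat) (P : {set {set T}}) : Prop :=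
  partition P [set: T] /\ #|P| = k.

Definition cut_edges (P : {set {set T}}) : {set {set T}} :=
  [set [set x; y] | x in T, y in T & adj G x y && (pblock P x != pblock P y)].

Definition is_min_kcut (k : nat) (P : {set {set T}}) : Prop :=
  is_kcut k P /\
  forall Q : {set {set T}}, is_kcut k Q -> #|cut_edges P| <= #|cut_edges Q|.

Definition nontrivial_cut (P : {set {set T}}) : Prop :=
  forall S : {set T}, S \in P -> #|S| <> 1.

End SimpleGraphs.

(* Multigraphs: the edges are abstract names taken in E, so that parallel edges
   are distinct and an edge keeps its identity when its endpoints change.  The
   values of [ends] outside [edges] are irrelevant. *)
Record mgraph (V E : finType) := MGraph {
  verts : {set V};
  edges : {set E};
  ends : E -> {set V}
}.

Definition mgraph_of (T : finType) (G : sgraph T) : mgraph T {set T} :=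
  MGraph [set: T] (edge_set G) id.

Section Contraction.
Variables V E : finType.

(* The vertices u and v (not necessarily adjacent) are replaced by a single one,
   for which the name u is reused. *)
Definition contract (u v : V) (H : mgraph V E) : mgraph V E :=
  MGraph (verts H :\ v)
         [set a in edges H | ends H a != [set u; v]]
         (fun a => [set (if w == v then u else w) | w in ends H a]).

Inductive contracts_to (H : mgraph V E) : mgraph V E -> Prop :=
| contracts_refl : contracts_to H H
| contracts_step (H' : mgraph V E) (u v : V) :
    contracts_to H H' -> u \in verts H' -> v \in verts H' -> u != v ->
    contracts_to H (contract u v H').

End Contraction.

(* Imported only here: mathcomp.classical shadows [partition] and [pblock] of
   finset. *)
From mathcomp Require Import all_classical all_reals all_analysis.
Local Open Scope classical_set_scope.
Local Open Scope ring_scope.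

Section Asymptotics.
Variable R : realType.

(* f = omega(g) as n tends to infinity, uniformly in the parameters alpha >= 1
   and k, which may thus vary arbitrarily with n. *)
Definition little_omega (f g : nat -> R -> nat -> R) : Prop :=
  forall M : R, \forall n \near \oo,
    forall (alpha : R) (k : nat), 1 <= alpha ->
      M * g n alpha k <= f n alpha k.

(* The bound K x (log n)^d: a quantity is soft-O(x) when it is at most
   [soft_bound K d n x] for constants K and d. *)
Definition soft_bound (K : R) (d n : nat) (x : R) : R :=
  K * x * ln n%:R ^+ d.

End Asymptotics.

(* Main.v *)
Require Import Defs.
From mathcomp Require Import all_boot all_order all_algebra zify lra ring.
Set Implicit Arguments.
Unset Strict Implicit.
Unset Printing Implicit Defensive.

(* Let a be about alpha.  Minimizing (number of intercluster arcs)
   + 8 a (sum over clusters C of |C| log |C|) over all clusterings gives at most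
   8 a n log n intercluster arcs, while any A in a cluster C with |A| <= |C|/2 has
   at least 4 a |A| edges to the rest of C.  A cut of at most a delta edges therefore
   leaves all but delta/4 vertices of a cluster in a single part S, unless the
   cluster has at most delta/2 vertices.  A vertex in the core of the cluster, i.e.
   with at least 4/5 of its neighbours inside, would then have most of its
   neighbours in S; if it were outside S, moving it to S would shrink the cut, and
   would keep it a k-cut if no part is a singleton.  So cores are never separated and
   may be contracted.  The edges which survive are intercluster or meet a noncore
   vertex, hence are at most a constant times the intercluster ones.  The number of
   vertices is bounded because a vertex has degree at least delta, so that its
   fibre or its number of surviving edges is at least delta/2. *)

(** * Counting edges as ordered pairs *)

Section Arcs.
Variable T : finType.
Implicit Types (q : rel T) (x y : T).

(** Ordered pairs allow termwise comparison of double sums, at the price of counting each edge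
    twice. *)
Definition arcs q : nat := \sum_x \sum_y q x y.

Lemma card_unordered_pairs q : symmetric q -> irreflexive q ->
  #|[set [set x; y] | x in T, y in T & q x y]| * 2 = arcs q.
Proof.
move=> q_sym q_irr; rewrite /arcs pair_big /=.
under eq_bigr do rewrite -[nat_of_bool _]/(if _ then 1 else 0).
rewrite -big_mkcond /= (partition_big (fun p : T * T => [set p.1; p.2])
  (mem [set [set x; y] | x in T, y in T & q x y])) /=; last first.
  by move=> [x y] qxy; apply/imset2P; exists x y; rewrite ?inE.
rewrite -sum_nat_const; apply: eq_bigr => e /imset2P[x y _].
rewrite inE => /= qxy ->.
have xNy : x != y by apply: contraTneq qxy => ->; rewrite q_irr.
rewrite sum1dep_card (_ : 2 = #|[set (x, y); (y, x)]|); last first.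
  by rewrite cards2 xpair_eqE negb_and xNy.
congr #|pred_of_set _|; apply/setP => -[u v]; rewrite !inE /= !xpair_eqE; apply/idP/idP.
  by case/orP=> /andP[/eqP-> /eqP->]; rewrite ?(setUC [set y]) eqxx ?[q y x]q_sym qxy.
case/andP=> quv /eqP uvE.
have uNv : u != v by apply: contraTneq quv => ->; rewrite q_irr.
have := set21 u v; have := set22 u v; rewrite uvE !inE.
by move=> /orP[]/eqP vE /orP[]/eqP uE; move: uNv; rewrite uE vE !eqxx ?orbT.
Qed.

Lemma leq_arcs q q' : (forall x y, q x y -> q' x y) -> arcs q <= arcs q'.
Proof.
move=> sqq'; apply: leq_sum => x _; apply: leq_sum => y _.
by case: (q x y) (@sqq' x y) => // ->.
Qed.

(** Isolates the share of [x], to compare colourings that differ only at [x]. *)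
Lemma arcsD1 q x : symmetric q -> irreflexive q ->
  arcs q = (\sum_y q x y) * 2 + \sum_(y | y != x) \sum_(z | z != x) q y z.
Proof.
move=> q_sym q_irr; rewrite /arcs (bigD1 x) //= muln2 -addnn -addnA; congr addn.
under eq_bigr do rewrite (bigD1 x) //=.
rewrite big_split /= [in RHS](bigD1 x) //= q_irr; congr addn.
by apply: eq_bigr => y _; rewrite q_sym.
Qed.

End Arcs.

(** * Contractions along a map; k-cuts as colourings *)

Section Graph.
Variables (T : finType) (G : sgraph T).
Implicit Types (x y z : T).

Lemma sum_degree x : degree G x = \sum_y adj G x y.
Proof. by rewrite /degree cardsE -sum1_card big_mkcond. Qed.

(** One relation serves cuts ([c = pblock P]), clusterings and contraction maps. *)
Definition bichromatic (L : eqType) (c : T -> L) : rel T :=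
  fun x y => adj G x y && (c x != c y).

Lemma bichromatic_sym (L : eqType) (c : T -> L) : symmetric (bichromatic c).
Proof. by move=> x y; rewrite /bichromatic adj_sym eq_sym. Qed.

Lemma bichromatic_irrefl (L : eqType) (c : T -> L) : irreflexive (bichromatic c).
Proof. by move=> x; rewrite /bichromatic adj_irrefl. Qed.

Lemma card_edge_set : #|edge_set G| * 2 = \sum_x degree G x.
Proof.
rewrite card_unordered_pairs; [|exact: adj_sym|exact: adj_irrefl].
by apply: eq_bigr => x _; rewrite sum_degree.
Qed.

Lemma card_cut_edges P : #|cut_edges G P| * 2 = arcs (bichromatic (pblock P)).
Proof.
by rewrite -card_unordered_pairs //; [exact: bichromatic_sym|exact: bichromatic_irrefl].
Qed.

(** Each vertex [x] of [G] ends up inside the vertex of [H] named [f x]. *)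
Definition contracted_by (f : T -> T) (H : mgraph T {set T}) : Prop :=
  [/\ contracts_to (mgraph_of G) H, verts H = [set f x | x in T],
      edges H = [set [set x; y] | x in T, y in T & bichromatic f x y] &
      forall e, ends H e = [set f x | x in e]].

Lemma contracted_by_ext f f' H : f =1 f' -> contracted_by f H -> contracted_by f' H.
Proof.
move=> ff' [GH vH eH endsH]; split=> //.
- by rewrite vH; apply: eq_imset.
- rewrite eH; apply/setP => e; apply/imset2P/imset2P => -[x y _];
    by rewrite inE /bichromatic => /= bxy ->; exists x y;
      rewrite // inE /= /bichromatic ?ff' // -?ff'.
- by move=> e; rewrite endsH; apply: eq_imset.
Qed.

Lemma contracted_by_step f H u v : contracted_by f H ->
  u \in verts H -> v \in verts H -> u != v ->
  contracted_by (fun x => if f x == v then u else f x) (contract u v H).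
Proof.
move=> [GH vH eH endsH] uH vH' uNv; split=> /=.
- exact: contracts_step.
- apply/setP => w; rewrite vH in uH vH' *; rewrite !inE; apply/andP/imsetP.
    by case=> wNv /imsetP[x _ wE]; exists x; rewrite // -wE (negbTE wNv).
  case=> x _; case: ifP => [_ ->|/negbT fxNv ->]; first by rewrite uNv.
  by rewrite fxNv imset_f.
- apply/setP => e; rewrite inE eH; apply/andP/imset2P.
    case=> /imset2P[x y _]; rewrite inE => /= /andP[axy fxy] -> /=.
    rewrite endsH => Nuv; exists x y; rewrite // inE /= /bichromatic axy /=.
    apply: contra Nuv; rewrite imsetU1 imset_set1.
    case: (f x =P v) => [fxv|_]; case: (f y =P v) => [fyv|_] /eqP.
    + by rewrite fxv fyv eqxx in fxy.
    + by move=> <-; rewrite fxv setUC.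
    + by move=> ->; rewrite fyv.
    + by move=> fxE; rewrite fxE eqxx in fxy.
  case=> x y _; rewrite inE => /= /andP[axy fxy] -> /=; split.
    apply/imset2P; exists x y; rewrite // inE /= /bichromatic axy /=.
    by apply: contraNneq fxy => ->.
  rewrite endsH imsetU1 imset_set1; apply: contra fxy => /eqP fE.
  have : f x \in [set u; v] by rewrite -fE set21.
  have : f y \in [set u; v] by rewrite -fE set22.
  by rewrite !inE => /orP[]/eqP-> /orP[]/eqP->; rewrite ?eqxx ?(negbTE uNv) ?eqxx.
- by move=> e; rewrite endsH -imset_comp.
Qed.

(** The vertices [x] are contracted into [f x] one by one; by idempotence the target [f x] is never
    contracted away. *)
Lemma idempotent_contraction f : (forall x, f (f x) = f x) ->
  exists H, contracted_by f H.
Proof.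
move=> f_idem.
suff [H GH] : exists H, contracted_by (fun x => if x \in enum T then f x else x) H.
  by exists H; apply: contracted_by_ext GH => x; rewrite mem_enum.
elim: (enum T) => [|x s [H GH]].
  exists (mgraph_of G); split=> //=.
  - exact: contracts_refl.
  - by apply/setP => x; rewrite inE; apply/esym/imsetP; exists x.
  - have bE x y : bichromatic (fun z => z) x y = adj G x y.
      by rewrite /bichromatic andb_idr // => axy; apply: contraTneq axy => ->; rewrite adj_irrefl.
    by apply/setP => e; apply/imset2P/imset2P => -[x y _]; rewrite inE /= => axy ->;
      exists x y; rewrite // inE /= ?bE // -bE.
  - by move=> e; rewrite -[LHS]imset_id; apply: eq_imset.
have [fx|fxNx] := eqVneq (f x) x.
  exists H; apply: contracted_by_ext GH => y; rewrite inE.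
  by case: eqVneq => //= ->; rewrite fx if_same.
have [xs|xNs] := boolP (x \in s).
  exists H; apply: contracted_by_ext GH => y; rewrite inE.
  by case: eqVneq => //= ->; rewrite xs.
exists (contract (f x) x H).
have [_ vH _ _] := GH.
have xH : x \in verts H by rewrite vH; apply/imsetP; exists x; rewrite // (negbTE xNs).
have fxH : f x \in verts H.
  by rewrite vH; apply/imsetP; exists (f x); rewrite // f_idem if_same.
apply: contracted_by_ext (contracted_by_step GH fxH xH fxNx) => y.
rewrite inE; have [->|yNx] /= := eqVneq y x; first by rewrite (negbTE xNs) eqxx.
case: (y \in s) => /=; last by rewrite (negbTE yNx).
(* [f y = x] would make [x] a value of [f], hence a fixed point. *)
by case: eqP => // fyx; rewrite -fyx f_idem fyx eqxx in fxNx.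
Qed.

Lemma exists_kcut_of (L : finType) (c : T -> L) :
  exists2 P, is_kcut #|[set c x | x in T]| P &
    forall x y, (pblock P x == pblock P y) = (c x == c y).
Proof.
pose P := preim_partition c [set: T].
have partP : partition P [set: T] := preim_partitionP c _.
have PE x y : (pblock P x == pblock P y) = (c x == c y).
  rewrite eq_pblock ?(partition_trivIset partP) ?(cover_partition partP) ?inE //.
  by rewrite pblock_equivalence_partition ?inE // => u v w _ _ _; split=> // /eqP->.
exists P => //; split=> //.
have -> : P = [set pblock P x | x in T].
  apply/setP => S; apply/idP/imsetP => [SP|[x _ ->]].
    have [S0|[x xS]] := set_0Vmem S.
      by case/and3P: partP => _ _; rewrite -S0 SP.
    by exists x; rewrite // (def_pblock (partition_trivIset partP) SP xS).
  by rewrite pblock_mem // (cover_partition partP) inE.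
pose h l := odflt set0 [pick S | [exists x, (c x == l) && (S == pblock P x)]].
have hE x : h (c x) = pblock P x.
  rewrite /h; case: pickP => [S /existsP[y /andP[cyx /eqP->]]|/(_ (pblock P x))].
    by apply/eqP; rewrite PE.
  by move/existsP => [] ; exists x; rewrite !eqxx.
rewrite -(eq_imset _ hE) (imset_comp h c) card_in_imset //.
by move=> _ _ /imsetP[x _ ->] /imsetP[y _ ->]; rewrite !hE => /eqP; rewrite PE => /eqP.
Qed.

(* Otherwise moving x into the part of y would give a smaller k-cut; the part of
   x stays nonempty because the cut is nontrivial. *)
Lemma min_kcut_locally_optimal k P x y : is_min_kcut G k P -> nontrivial_cut P ->
  \sum_z (adj G x z && (pblock P z != pblock P x))
    <= \sum_z (adj G x z && (pblock P z != pblock P y)).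
Proof.
move=> [[partP cardP] minP] ntP; set c := pblock P.
pose c' z := if z == x then c y else c z.
have cP z : c z \in P by rewrite pblock_mem // (cover_partition partP) inE.
have [Q kcutQ QE] := exists_kcut_of c'.
have im_c' : [set c' z | z in T] = P.
  apply/setP => S; apply/imsetP/idP => [[z _ ->]|SP].
    by rewrite /c'; case: ifP.
  (* A part is neither empty nor [[set x]], so it keeps a vertex when [x] moves: all k colours stay
     in use. *)
  have [z [zS zNx]] : exists z, z \in S /\ z != x.
    have [Sx|[z /setD1P[zNx zS]]] := set_0Vmem (S :\ x); last by exists z.
    have [S0|[z zS]] := set_0Vmem S; first by case/and3P: partP => _ _; rewrite -S0 SP.
    have zx : z = x by apply/eqP; apply: contraT => zNx; rewrite -(in_set0 z) -Sx !inE zNx.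
    by case: (ntP _ SP); rewrite (cardsD1 x) Sx cards0 -zx zS.
  exists z => //; rewrite /c' (negbTE zNx).
  by rewrite /c (def_pblock (partition_trivIset partP) SP zS).
have arcs_le : arcs (bichromatic c) <= arcs (bichromatic c').
  have: #|cut_edges G P| * 2 <= #|cut_edges G Q| * 2.
    by rewrite leq_mul2r minP // -cardP -im_c'.
  rewrite !card_cut_edges => /leq_trans; apply.
  by apply: leq_arcs => u v; rewrite /bichromatic QE.
rewrite !(arcsD1 x (bichromatic_sym _) (bichromatic_irrefl _)) in arcs_le.
have E : \sum_(u | u != x) \sum_(v | v != x) bichromatic c u v =
         \sum_(u | u != x) \sum_(v | v != x) bichromatic c' u v.
  apply: eq_bigr => u uNx; apply: eq_bigr => v vNx.
  by rewrite /bichromatic /c' (negbTE uNx) (negbTE vNx).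
rewrite E leq_add2r leq_mul2r /= in arcs_le.
have -> : \sum_z (adj G x z && (c z != c x)) = \sum_z bichromatic c x z.
  by apply: eq_bigr => z _; rewrite /bichromatic eq_sym.
apply: leq_trans arcs_le _; apply: leq_sum => z _.
rewrite /bichromatic /c' eqxx; have [->|_] := eqVneq z x; first by rewrite adj_irrefl.
by rewrite eq_sym.
Qed.
End Graph.

(** * Expanding clusterings by a potential argument *)

Section Clustering.
Variables (T : finType) (G : sgraph T).
Implicit Types (x y z : T) (A C : {set T}).

Definition cluster (L : eqType) (g : T -> L) x : {set T} := [set y | g y == g x].

Definition crossing C A : rel T :=
  fun x y => [&& adj G x y, x \in C, y \in C & (x \in A) != (y \in A)].

(* Take g minimizing [arcs (bichromatic G g)] plus h times the sum of
   [trunc_log 2 #|cluster g x|]: recolouring A with a fresh colour decreases the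
   logarithm by 1 at least on A. *)
Lemma exists_expanding_clustering (h : nat) :
  exists g : T -> option T,
    arcs (bichromatic G g) <= h * (#|T| * trunc_log 2 #|T|) /\
    forall x A, A \subset cluster g x -> 2 * #|A| <= #|cluster g x| ->
      h * #|A| <= arcs (crossing (cluster g x) A).
Proof.
pose pot (g : {ffun T -> option T}) :=
  arcs (bichromatic G g) + h * \sum_x trunc_log 2 #|cluster g x|.
have [g _ g_min] := arg_minnP pot (i0 := [ffun=> None]) (P := predT) isT.
exists g; split.
  have := g_min [ffun=> None] isT; rewrite /pot.
  have -> : arcs (bichromatic G [ffun=> (None : option T)]) = 0.
    rewrite /arcs big1 // => x _; rewrite big1 // => y _.
    by rewrite /bichromatic !ffunE eqxx andbF.
  have -> : \sum_x trunc_log 2 #|cluster [ffun=> (None : option T)] x|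
            = #|T| * trunc_log 2 #|T|.
    rewrite -sum_nat_const; apply: eq_bigr => x _; congr trunc_log.
    by rewrite /cluster -cardsT; congr #|pred_of_set _|; apply/setP => y; rewrite !inE !ffunE eqxx.
  by apply: leq_trans; apply: leq_addr.
move=> x A AC A_small.
(* [option T] has more elements than [g] can have values, so a colour is free. *)
have [l lP] : exists l, l \notin codom g.
  apply/existsP; rewrite -negb_forall; apply/negP => /forallP all_g.
  have: #|codom g| <= #|T|.
    by rewrite -(size_codom g) card_size.
  by rewrite (eq_card (B := predT)) ?card_option ?ltnn // => l; rewrite all_g.
pose g1 := [ffun y => if y \in A then l else g y].
have Ng y : (l == g y) = false by apply: contraNF lP => /eqP->; apply: codom_f.
have gN y : (g y == l) = false by rewrite eq_sym.
have arcs_le : arcs (bichromatic G g1) <= arcs (bichromatic G g) + arcs (crossing (cluster g x) A).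
  rewrite -big_split; apply: leq_sum => y _; rewrite -big_split; apply: leq_sum => z _ /=.
  rewrite /bichromatic /crossing !ffunE; case: (adj G y z) => //=.
  have cA w : w \in A -> w \in cluster g x by move/(subsetP AC).
  have [yA|yA] := boolP (y \in A); have [zA|zA] := boolP (z \in A);
    rewrite /= ?eqxx ?andbF ?andbT ?addn0 //.
  - rewrite Ng (cA y yA) /= ?andbT; have := cA _ yA; rewrite !inE => /eqP->.
    by rewrite eq_sym; case: eqP.
  - rewrite gN (cA z zA) /= ?andbT; have := cA _ zA; rewrite !inE => /eqP->.
    by case: eqP.
(* Vertices of [A] pass from a cluster of size at least [2 * #|A|] to one of size [#|A|]; the other
   clusters can only shrink. *)
have log_le : \sum_y trunc_log 2 #|cluster g1 y| + #|A| <= \sum_y trunc_log 2 #|cluster g y|.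
  rewrite -sum1_card [X in _ + X]big_mkcond -big_split; apply: leq_sum => y _ /=.
  have [yA|yA] := boolP (y \in A).
    have -> : cluster g1 y = A.
      by apply/setP => z; rewrite inE !ffunE yA; case: (z \in A); rewrite ?eqxx ?gN.
    have -> : cluster g y = cluster g x.
      by have := subsetP AC _ yA; rewrite inE => /eqP E; apply/setP => z; rewrite !inE E.
    rewrite addn1 -trunc_logMp //; last by apply/card_gt0P; exists y.
    exact: leq_trunc_log.
  rewrite addn0 leq_trunc_log // subset_leq_card //; apply/subsetP => z.
  by rewrite !inE !ffunE (negbTE yA); case: (z \in A); rewrite ?Ng.
have arith (b b1 e s s1 t : nat) :
    b1 <= b + e -> s1 + t <= s -> b + h * s <= b1 + h * s1 -> h * t <= e.
  by nia.
exact: arith arcs_le log_le (g_min g1 isT).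
Qed.

End Clustering.

(** * Cores of clusters and their contraction *)

Section Cores.
Variables (T : finType) (G : sgraph T) (g : T -> option T).
Implicit Types (x y z : T).

Definition out_degree x : nat := \sum_y bichromatic G g x y.

Definition core : {set T} := [set x | 5 * out_degree x <= degree G x].

(** If some colour takes half of the cluster, all its core vertices have that colour. Otherwise the
    expansion of all colour classes bounds the cluster by [delta / 2], too few for 4/5 of the
    neighbours of [x]. *)
Lemma core_monochromatic (a delta : nat) (L : finType) (c : T -> L) :
    0 < a -> 0 < delta -> (forall x, delta <= degree G x) ->
    (forall x (A : {set T}), A \subset cluster g x -> 2 * #|A| <= #|cluster g x| ->
      8 * a * #|A| <= arcs (crossing G (cluster g x) A)) ->
    (forall x y, \sum_z (adj G x z && (c z != c x)) <= \sum_z (adj G x z && (c z != c y))) ->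
    arcs (bichromatic G c) <= 2 * a * delta ->
  forall x y, x \in core -> y \in core -> g x = g y -> c x = c y.
Proof.
move=> a_gt0 delta_gt0 min_deg g_expanding c_opt c_small x y xcore ycore gxy.
have [C CE] : exists C, C = cluster g x by exists (cluster g x).
have inC z : (z \in C) = (g z == g x) by rewrite CE inE.
have C_expanding := g_expanding x; rewrite -CE in C_expanding.
pose A l := [set z in C | c z == l].
have AC l : A l \subset C by apply/subsetP => z; rewrite inE => /andP[].
have [/existsP[l Al_big]|/existsPn Al_small] := boolP [exists l, #|C| <= 2 * #|A l|].
  have xC : x \in C by rewrite inC.
  have [w /setIdP[wC /eqP cw]] : exists w, w \in A l.
    apply/card_gt0P; have: 0 < #|C| by apply/card_gt0P; exists x.
    by lia.
  have B_small : 4 * #|C :\: A l| <= delta.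
    have: 8 * a * #|C :\: A l| <= arcs (bichromatic G c).
      apply: leq_trans (leq_arcs _).
        apply: C_expanding; rewrite ?subsetDl //.
        by have := cardsID (A l) C; rewrite (setIidPr (AC l)); lia.
      move=> u v /and4P[auv uC vC]; rewrite !inE uC vC !andbT /bichromatic auv /=.
      by apply: contra => /eqP->.
    by nia.
  (* Off colour [l], [z] would have at most [out_degree z + delta / 4] neighbours of its own colour
     and, by local optimality, no more than that of other colours: at most 9/10 of its degree in
     all. *)
  have core_l z : z \in core -> z \in C -> c z = l.
    rewrite inE => z_core zC; apply/eqP/contraT => czNl.
    have le_own : \sum_u (adj G z u && (c u == c z)) <= \sum_u (adj G z u && (c u != l)).
      by apply: leq_sum => u _; case: eqP => [->|]; rewrite ?czNl ?andbF.
    have le_out : \sum_u (adj G z u && (c u != l)) <= out_degree z + #|C :\: A l|.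
      rewrite -sum1_card [X in _ + X]big_mkcond -big_split; apply: leq_sum => u _ /=.
      rewrite !inE /bichromatic; case: (adj G z u) => //=.
      move: zC; rewrite !inC => /eqP->; rewrite eq_sym.
      by rewrite [g x == _]eq_sym; case: (g u == g x); case: (l == c u).
    have := c_opt z w; rewrite cw => le_opt.
    have degE : degree G z = \sum_u (adj G z u && (c u == c z)) + \sum_u (adj G z u && (c u != c z)).
      rewrite sum_degree -big_split; apply: eq_bigr => u _ /=.
      by case: (adj G z u); case: (c u == c z).
    by have := min_deg z; lia.
  by rewrite !core_l // inC gxy.
have C_le : 8 * a * #|C| <= 2 * arcs (bichromatic G c).
  have -> : #|C| = \sum_l #|A l|.
    rewrite -sum1_card (partition_big c predT) //=; apply: eq_bigr => l _.
    by rewrite sum1dep_card.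
  rewrite big_distrr /=.
  apply: (@leq_trans (\sum_l arcs (crossing G C (A l)))).
    by apply: leq_sum => l _; apply: C_expanding => //; have := Al_small l; lia.
  (* An arc with ends of distinct colours crosses only the classes of these two colours, hence the
     factor 2. *)
  rewrite exchange_big big_distrr; apply: leq_sum => u _ /=.
  rewrite exchange_big big_distrr; apply: leq_sum => v _ /=.
  rewrite /bichromatic /crossing; case: (adj G u v) => /=; last by rewrite big1.
  have [cuv|cuv] := eqVneq (c u) (c v).
    rewrite big1 // => l _; case: (boolP (u \in C)) => //= uC.
    by case: (boolP (v \in C)) => //= vC; rewrite !inE cuv uC vC eqxx.
  rewrite muln1; apply: (@leq_trans (\sum_l ((l == c u) + (l == c v)))).
    apply: leq_sum => l _; case: (boolP (u \in C)) => //= uC; case: (boolP (v \in C)) => //= vC.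
    rewrite inE [v \in A l]inE uC vC /= ![_ == l]eq_sym.
    by case: (l == c u); case: (l == c v).
  rewrite big_split /=.
  have S1 d : \sum_(l : L) (l == d) = 1.
    by rewrite (bigD1 d) //= eqxx big1 // => l /negbTE->.
  by rewrite !S1.
have deg_le : degree G x <= out_degree x + #|C|.
  rewrite sum_degree -sum1_card [X in _ + X]big_mkcond -big_split; apply: leq_sum => u _ /=.
  by rewrite inC /bichromatic [g u == _]eq_sym; case: (adj G x u); case: (g x == g u).
move: xcore; rewrite inE; have := min_deg x.
by nia.
Qed.

(** For [x] in the core the default is never taken, since [x] itself qualifies; the choice then
    depends on [g x] only. *)
Definition core_rep x : T :=
  if x \in core then odflt x [pick y in core | g y == g x] else x.

Lemma core_rep_core x : x \in core -> core_rep x \in core /\ g (core_rep x) = g x.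
Proof.
move=> xc; rewrite /core_rep xc; case: pickP => [y /andP[yc /eqP]//|/(_ x)].
by rewrite xc eqxx.
Qed.

Lemma core_rep_inj x y : core_rep x = core_rep y ->
  x = y \/ [/\ x \in core, y \in core & g x = g y].
Proof.
have [xc|xc] := boolP (x \in core); have [yc|yc] := boolP (y \in core).
- by have [_ <-] := core_rep_core xc; have [_ <-] := core_rep_core yc => ->; right.
- have [rx _] := core_rep_core xc; rewrite [core_rep y]/core_rep (negbTE yc) => ry.
  by rewrite -ry rx in yc.
- have [ry _] := core_rep_core yc; rewrite [core_rep x]/core_rep (negbTE xc) => rx.
  by rewrite rx ry in xc.
- by rewrite /core_rep (negbTE xc) (negbTE yc); left.
Qed.

Lemma core_rep_eq x y : x \in core -> y \in core -> g x = g y -> core_rep x = core_rep y.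
Proof.
move=> xc yc gxy; rewrite /core_rep xc yc gxy.
by case: pickP => // /(_ y); rewrite yc eqxx.
Qed.

Lemma core_rep_idem x : core_rep (core_rep x) = core_rep x.
Proof.
have [xc|xc] := boolP (x \in core); last by rewrite /core_rep !(negbTE xc).
by have [rc gr] := core_rep_core xc; apply: core_rep_eq.
Qed.

(** 11 = 1 + 5 + 5: a surviving arc is intercluster, or starts or ends at a noncore vertex, whose
    degree is below 5 times its [out_degree]. *)
Lemma arcs_core_rep : arcs (bichromatic G core_rep) <= 11 * arcs (bichromatic G g).
Proof.
have noncore : \sum_x \sum_y (adj G x y && (x \notin core)) <= 5 * arcs (bichromatic G g).
  rewrite big_distrr; apply: leq_sum => x _ /=.
  have [xc|xc] := boolP (x \in core).
    by rewrite big1 // => y _; rewrite andbF.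
  under eq_bigr do rewrite andbT.
  by rewrite -sum_degree ltnW // ltnNge; rewrite inE in xc.
have noncoreC : \sum_x \sum_y (adj G x y && (y \notin core)) <= 5 * arcs (bichromatic G g).
  rewrite exchange_big; apply: leq_trans noncore.
  by apply: leq_sum => x _; apply: leq_sum => y _;
    rewrite adj_sym.
apply: (@leq_trans (arcs (bichromatic G g) + (\sum_x \sum_y (adj G x y && (x \notin core))
    + \sum_x \sum_y (adj G x y && (y \notin core))))); last by lia.
rewrite -!big_split; apply: leq_sum => x _; rewrite -!big_split; apply: leq_sum => y _ /=.
rewrite /bichromatic; case: (adj G x y) => //=.
case: (boolP (x \in core)) => xc; case: (boolP (y \in core)) => yc;
  rewrite ?addn0 ?add0n ?addn1 ?addnS; case: eqP => //= rNeq.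
by case: eqP => // /(core_rep_eq xc yc).
Qed.

End Cores.

(* A vertex v with f v = v has at most #|f^-1(v)| neighbours in its own fibre. *)
Lemma idempotent_image_bound (T : finType) (G : sgraph T) (delta : nat) (f : T -> T) :
  (forall x, delta <= degree G x) -> (forall x, f (f x) = f x) ->
  delta * #|[set f x | x in T]| <= #|T| + arcs (bichromatic G f).
Proof.
move=> min_deg f_idem; rewrite mulnC -sum_nat_const.
apply: (@leq_trans (\sum_(v in [set f x | x in T])
    (\sum_y (f y == v) + \sum_y bichromatic G f v y))).
  apply: leq_sum => _ /imsetP[x _ ->]; apply: leq_trans (min_deg (f x)) _.
  rewrite sum_degree -big_split; apply: leq_sum => y _ /=.
  rewrite /bichromatic f_idem eq_sym; case: (adj G _ y) => //=.
  by case: (f x == f y).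
rewrite big_split leq_add //=; last first.
  by rewrite big_mkcond; apply: leq_sum => v _; case: ifP.
(* Each [y] lies in exactly one fibre, so the fibres have [#|T|] vertices in all. *)
rewrite exchange_big -sum1_card; apply: leq_sum => y _ /=.
rewrite big_mkcond (bigD1 (f y)) //= eqxx imset_f // big1 // => v vN.
by rewrite eq_sym (negbTE vN) if_same.
Qed.

(** Expansion [8 * a] costs a factor [8 * a] in intercluster arcs and the contraction a factor 11;
    44 = 11 * 8 / 2 as arcs count edges twice. *)
Lemma nontrivial_kcut_sparsifier (T : finType) (G : sgraph T) (a delta : nat) :
  0 < a -> 0 < delta -> (forall x, delta <= degree G x) ->
  exists H : mgraph T {set T},
    [/\ contracts_to (mgraph_of G) H,
        forall k P, is_min_kcut G k P -> nontrivial_cut P ->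
          #|cut_edges G P| <= a * delta -> cut_edges G P \subset edges H,
        #|edges H| <= 44 * a * (#|T| * trunc_log 2 #|T|) &
        delta * #|verts H| <= #|T| + 2 * #|edges H|].
Proof.
move=> a_gt0 delta_gt0 min_deg.
have [g [arcs_g g_exp]] := exists_expanding_clustering G (8 * a).
have [H [GH vH eH _]] := idempotent_contraction G (core_rep_idem G g).
have card_eH : #|edges H| * 2 = arcs (bichromatic G (core_rep G g)).
  by rewrite eH card_unordered_pairs //; [exact: bichromatic_sym|exact: bichromatic_irrefl].
exists H; split=> //.
- move=> k P minP ntP small; rewrite eH; apply/subsetP => e /imset2P[x y _].
  rewrite inE => /= /andP[axy cxy] ->.
  apply/imset2P; exists x y; rewrite // inE /= /bichromatic axy /=.
  apply: contra cxy => /eqP /core_rep_inj[->//|[xc yc gxy]]; apply/eqP.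
  apply: (core_monochromatic a_gt0 delta_gt0 min_deg g_exp _ _ xc yc gxy).
    by move=> u v; apply: min_kcut_locally_optimal minP ntP.
  by rewrite -card_cut_edges; lia.
- by have := arcs_core_rep G g; nia.
- have := idempotent_image_bound min_deg (core_rep_idem G g).
  by rewrite vH; lia.
Qed.

(* Passage to asymptotic bounds *)
From mathcomp Require Import all_classical all_reals all_analysis.
Import Order.TTheory GRing.Theory Num.Theory.
Local Open Scope classical_set_scope.
Local Open Scope ring_scope.

Lemma min_degree_le (T : finType) (G : sgraph T) (x : T) :
  (min_degree G <= degree G x)%N.
Proof. by rewrite -leEnat; apply: bigmin_le_cond. Qed.

Lemma trunc_log_ln (R : realType) (n : nat) : (0 < n)%N ->
  (trunc_log 2 n)%:R * ln 2 <= ln n%:R :> R.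
Proof.
move=> n_gt0; rewrite mulr_natl -lnXn // -natrX ler_ln ?posrE ?ltr0n ?expn_gt0 //.
by rewrite ler_nat trunc_logP.
Qed.

Theorem theorem3p2 (R : realType) :
  exists (K : R) (d : nat),
  forall f : nat -> R -> nat -> R,
    little_omega f (fun n alpha k =>
      Num.max (alpha * ln n%:R) (alpha * k%:R)) ->
  \forall n \near \oo,
  forall (alpha : R) (k m delta : nat) (T : finType) (G : sgraph T),
    1 <= alpha ->
    #|T| = n ->
    #|edge_set G| = m ->
    min_degree G = delta ->
    f n alpha k < delta%:R ->
  exists H : mgraph T {set T},
    [/\ contracts_to (mgraph_of G) H,
        (exists2 P : {set {set T}}, is_min_kcut G k P &
           #|cut_edges G P|%:R <= alpha * delta%:R) ->
        forall P : {set {set T}}, is_min_kcut G k P -> nontrivial_cut P ->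
          cut_edges G P \subset edges H,
        #|edges H|%:R <= soft_bound K d n (alpha * m%:R / delta%:R) &
        #|verts H|%:R <= soft_bound K d n (alpha * m%:R / delta%:R ^+ 2)].
Proof.
have ln2_gt0 : 0 < ln 2 :> R by rewrite ln_gt0 // ltr1n.
(* 354 = 2 * 176 + 2 comes from [n + 2 * #|edges H|], and 176 = 44 * 2 * 2 from [a <= 2 * alpha] and
   [n <= 2 * m / delta]; [ln 2] changes the base of the logarithm. *)
exists (354 / ln 2), 1%N => f f_omega; near=> n.
move=> alpha k m delta T G alpha_ge1 cardT cardE degE f_lt.
have n_ge2 : (2 <= n)%N by near: n; exact: nbhs_infty_ge.
have f_ge : 1 * Num.max (alpha * ln n%:R) (alpha * k%:R) <= f n alpha k.
  (* [alpha] and [k] are generalised first: [little_omega] is uniform in them. *)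
  by move: alpha k alpha_ge1 {f_lt}; near: n; exact: f_omega.
have ln_ge : ln 2 <= ln n%:R :> R by rewrite ler_ln ?posrE ?ltr0n ?ler_nat // ltnW.
have delta_gt0 : 0 < delta%:R :> R.
  apply: le_lt_trans f_lt; apply: le_trans f_ge; rewrite mul1r le_max.
  by rewrite mulr_ge0 //; lra.
(* An integer in place of [alpha], at most [alpha + 1 <= 2 * alpha]. *)
pose a := (Num.truncn alpha).+1.
have alpha_lt : alpha < a%:R by exact: truncnS_gt.
have a_le : a%:R <= 2 * alpha.
  have : (Num.truncn alpha)%:R <= alpha by rewrite truncn_le; lra.
  by rewrite /a -natr1; lra.
have min_deg x : (delta <= degree G x)%N by rewrite -degE min_degree_le.
have handshake : (n * delta <= m * 2)%N.
  by rewrite -cardE card_edge_set -cardT -sum_nat_const leq_sum.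
have delta_gt0N : (0 < delta)%N by rewrite -(ltr_nat R).
have [H [GH H_cut H_edges H_verts]] :=
  nontrivial_kcut_sparsifier (isT : (0 < a)%N) delta_gt0N min_deg.
rewrite cardT in H_edges H_verts.
pose x : R := m%:R / delta%:R; pose c : R := ln n%:R / ln 2.
have n_le : n%:R <= 2 * x.
  rewrite /x mulrA ler_pdivlMr // [2 * _]mulrC.
  by move: handshake; rewrite -(ler_nat R) !natrM.
have c_ge1 : 1 <= c by rewrite /c ler_pdivlMr // mul1r.
have log_le : (trunc_log 2 n)%:R <= c.
  by rewrite /c ler_pdivlMr // trunc_log_ln // ltnW.
have x_ge0 : 0 <= x by rewrite divr_ge0.
have edges_le : #|edges H|%:R <= 176 * (alpha * x * c).
  have: #|edges H|%:R <= (44 * a * (n * trunc_log 2 n))%:R :> R by rewrite ler_nat.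
  move/le_trans; apply; rewrite !natrM.
  have -> : 176 * (alpha * x * c) = 44 * (2 * alpha) * (2 * x * c) by ring.
  by rewrite !ler_pM ?mulr_ge0 ?ler_wpM2l //; lra.
have axc_ge : x <= alpha * x * c.
  have ac : 1 <= alpha * c by nra.
  by nra.
have verts_le : delta%:R * #|verts H|%:R <= 354 * (alpha * x * c).
  have: (delta * #|verts H|)%:R <= (n + 2 * #|edges H|)%:R :> R by rewrite ler_nat.
  by rewrite natrD !natrM; lra.
exists H; split=> //.
(* [P] is minimum, so the bound on [Q] passes to it. *)
- move=> [Q [kcutQ _] Q_small] P minP ntP; apply: (H_cut k) => //.
  rewrite -(ler_nat R) natrM.
  have PQ : #|cut_edges G P|%:R <= #|cut_edges G Q|%:R :> R.
    by rewrite ler_nat; have [_] := minP; apply.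
  by apply: le_trans PQ (le_trans Q_small _); rewrite ler_pM2r // ltW.
- apply: le_trans edges_le _.
  have -> : soft_bound (354 / ln 2) 1 n (alpha * m%:R / delta%:R) = 354 * (alpha * x * c).
    by rewrite /soft_bound /x /c expr1; field; rewrite !gt_eqF.
  by lra.
- rewrite -(ler_pM2l delta_gt0); apply: le_trans verts_le _.
  rewrite le_eqVlt; apply/orP; left; apply/eqP.
  by rewrite /soft_bound /x /c expr1; field; rewrite !gt_eqF.
Unshelve. all: by end_near.
Qed.
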